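(* Every maximal independent family $F$ of computable sets uniformly computes a dominating function; in other words, $\mathrm{DomFcn}\le_s\mathcal{I}$.
   Context: For sets $A,B\subseteq\omega$, $A\subseteq^* B$ means $A\setminus B$ is finite; $\overline{R}=\omega\setminus R$. With $\langle\cdot,\cdot\rangle$ the usual computable Cantor pairing function on $\omega$, a set $X\subseteq\omega$ encodes the sequence $(X_n)_{n\in\omega}$ of its columns $X_n=\{u:\langle u,n\rangle\in X\}$. Given a sequence $(F_n)_{n\in\omega}$ of sets, let $F_{\emptyset}=\omega$ for the empty string, and for each nonempty finite binary string $\sigma$ let $F_\sigma=\bigcap_{\sigma(i)=1}F_i\cap\bigcap_{\sigma(i)=0}\overline{F_i}$ (where $i<|\sigma|$). The sequence is independent if each $F_\sigma$ is infinite. A sequence of computable sets is maximal independent (for the Boolean algebra of computable sets) if it is independent and for each computable set $R$ there is $\sigma$ such that $F_\sigma\subseteq^* R$ or $F_\sigma\subseteq^*\overline{R}$. $\mathcal{I}$ is the class of sets $F$ encoding a maximal independent sequence of computable sets. For $f,g\colon\omega\to\omega$, $g$ dominates $f$ if $g(n)\ge f(n)$ for all sufficiently large $n$. $\mathrm{DomFcn}$ is the class of functions $h\colon\omega\to\omega$ that dominate every computable function and satisfy $h(s)\ge s$ for all $s$. Medvedev reducibility between classes of functions on $\omega$ (sets are identified with characteristic functions): $\mathcal{C}\le_s\mathcal{D}$ if there is a Turing functional $\Theta$ such that $\Theta^g\in\mathcal{C}$ for each $g\in\mathcal{D}$. *)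

(* Defs.v *)
From mathcomp Require Import all_boot.
From mathcomp Require Import boolp classical_sets functions cardinality.
From Stdlib Require Cantor.

Set Implicit Arguments.
Unset Strict Implicit.
Unset Printing Implicit Defensive.

Local Open Scope classical_set_scope.

(** <x, y> = y + (x + y)(x + y + 1) / 2 *)
Definition cpair (x y : nat) : nat := Cantor.to_nat (x, y).

(** Turing functionals are presented by codes for the partial functions of one
    argument that are partial recursive in an oracle; several arguments are
    passed as one pair-coded argument. *)
Inductive code : Type :=
| Zero
| Succ
| Left
| Right
| Oracle
| Pair of code & code
| Comp of code & code
| Prec of code & code
| Mu of code.

Definition prec_graph (base step : nat -> nat -> Prop) (p : nat) :
    nat -> nat -> Prop :=
  fix graph n y :=
    if n is k.+1 then exists2 r, graph k r & step (cpair p (cpair k r)) y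
    else base p y.

(** [eval g e x y]: the computation of [e] on input [x] with oracle [g]
    converges with output [y].  [Mu a] searches for the least [y] such that
    [a] outputs 0 on <x, y>, all computations at smaller arguments being
    required to converge. *)
Fixpoint eval (g : nat -> nat) (e : code) : nat -> nat -> Prop :=
  match e with
  | Zero => fun _ y => y = 0
  | Succ => fun x y => y = x.+1
  | Left => fun x y => y = (Cantor.of_nat x).1
  | Right => fun x y => y = (Cantor.of_nat x).2
  | Oracle => fun x y => y = g x
  | Pair a b => fun x y =>
      exists u v, [/\ eval g a x u, eval g b x v & y = cpair u v]
  | Comp a b => fun x y => exists2 u, eval g b x u & eval g a u y
  | Prec a b => fun x y =>
      prec_graph (eval g a) (eval g b) (Cantor.of_nat x).1 (Cantor.of_nat x).2 y
  | Mu a => fun x y =>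
      eval g a (cpair x y) 0 /\
      forall j, j < y -> exists v, eval g a (cpair x j) v.+1
  end.

Lemma eval_functional g e x y z : eval g e x y -> eval g e x z -> y = z.
Proof.
elim: e x y z => [||||| a IHa b IHb | a IHa b IHb | a IHa b IHb | a IHa] x y z /=.
1-5: by move=> -> ->.
- move=> [u [v [au bv ->]]] [u' [v' [au' bv' ->]]].
  by rewrite (IHa _ _ _ au au') (IHb _ _ _ bv bv').
- by move=> [u bu ay] [u' bu' az]; move: az; rewrite -(IHb _ _ _ bu bu'); apply: IHa.
- elim: (Cantor.of_nat x).2 y z => [|n IHn] y z /=; first exact: IHa.
  by move=> [r nr by_] [r' nr' bz]; move: bz; rewrite -(IHn _ _ nr nr'); apply: IHb.
- move=> [ay lty] [az ltz]; case: (ltngtP y z) => // [/ltz|/lty] [v av].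
  + by have := IHa _ _ _ ay av.
  + by have := IHa _ _ _ az av.
Qed.

Fixpoint oracle_free (e : code) : bool :=
  match e with
  | Zero | Succ | Left | Right => true
  | Oracle => false
  | Pair a b | Comp a b | Prec a b => oracle_free a && oracle_free b
  | Mu a => oracle_free a
  end.

(** Since [e] does not consult the oracle, the quantification over [g] is
    immaterial. *)
Definition computable (f : nat -> nat) : Prop :=
  exists2 e : code, oracle_free e & forall g n, eval g e n (f n).

Definition char_fun (X : set nat) (n : nat) : nat := nat_of_bool (n \in X).

Definition computable_set (X : set nat) : Prop := computable (char_fun X).

Definition almost_sub (A B : set nat) : Prop := finite_set (A `\` B).

Definition column (X : set nat) (n : nat) : set nat := [set u | X (cpair u n)].

(** F_sigma; the intersection over the empty index set is [setT]. *)
Definition string_set (F : nat -> set nat) (sigma : seq bool) : set nat :=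
  \bigcap_(i < size sigma) (if nth false sigma i then F i else ~` F i).

Definition independent (F : nat -> set nat) : Prop :=
  forall sigma, infinite_set (string_set F sigma).

Definition maximal_independent (F : nat -> set nat) : Prop :=
  [/\ forall n, computable_set (F n),
      independent F
    & forall R, computable_set R -> exists sigma,
        almost_sub (string_set F sigma) R \/
        almost_sub (string_set F sigma) (~` R)].

Definition MaxIndep : set (set nat) :=
  [set X | maximal_independent (column X)].

Definition dominates (g f : nat -> nat) : Prop :=
  exists N, forall n, N <= n -> f n <= g n.

Definition DomFcn : set (nat -> nat) :=
  [set h | (forall f, computable f -> dominates h f) /\ forall s, s <= h s].

Definition medvedev_le (C D : set (nat -> nat)) : Prop :=
  exists Theta : code, forall g, D g ->
    exists2 h, C h & forall n, eval g Theta n (h n).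

(* Main.v *)
Require Import Defs.
From mathcomp Require Import all_boot.
From mathcomp Require Import boolp classical_sets functions cardinality.
From mathcomp Require Import finmap zify.
From Stdlib Require Cantor.

Set Implicit Arguments.
Unset Strict Implicit.
Unset Printing Implicit Defensive.

Local Open Scope classical_set_scope.

(** The point is that, uniformly in a maximal independent sequence F, totality
    of a program e has a Sigma_2 definition with a witness that can only be
    refuted in finite time.  A witness is a finite string sigma with a bound N,
    and it stands for the infinite computable set T consisting of the elements
    of F_sigma that are at least N.

    Run e on 0, 1, 2, ... in stages, and cut omega into blocks: stages w and t
    lie in the same block when e has converged on an initial segment of the
    same length by both ([reach]).  If e is total, then all blocks are finite;
    otherwise there is a last block, which is cofinite.  While a block lasts,
    watch for each index i the elements of the block that program i has so far
    accepted ([marked]); the set of them becomes [large] once it has at least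
    2i + 2 elements.  A large set contained in T refutes the witness T.

    - If e is total, then some computable set R splits every large set of
      every block ([splitting_set]): when a block is over, its smallest large
      sets are finitely many, one for each i, and giving the one for i two fresh
      elements, one in R and one outside R, is possible because only 2i elements
      have been used before ([two_colouring]).  By maximality some F_sigma is
      almost contained in R or in its complement, so no large set is contained
      in the corresponding T, and T is never refuted ([total_unrefuted]).

    - If e(x) diverges, then T is a computable infinite set, hence the set
      accepted by some program i.  In the infinite last block more and more of
      its elements are accepted, so it refutes itself ([divergent_refuted]).

    Let h(x) be the least s >= x such that, for each pair of a program e and
    a witness coded below x, either e(x) has converged by stage s, with its
    value below s, or the witness has been refuted by stage s.  The second item
    makes h total ([halted_total]), and the first makes it dominate each
    computable function.  Since [halted] is decidable in F, a single unbounded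
    search computes h.

    Most of the remaining work shows that the ingredients are computed by
    codes, including a staged universal evaluator for oracle-free codes. *)

(** * Pairing *)

Definition pi1 (n : nat) : nat := (Cantor.of_nat n).1.
Definition pi2 (n : nat) : nat := (Cantor.of_nat n).2.

Lemma pi1_cpair x y : pi1 (cpair x y) = x.
Proof. by rewrite /pi1 /cpair Cantor.cancel_of_to. Qed.

Lemma pi2_cpair x y : pi2 (cpair x y) = y.
Proof. by rewrite /pi2 /cpair Cantor.cancel_of_to. Qed.

Lemma cpair_pi n : cpair (pi1 n) (pi2 n) = n.
Proof. by rewrite /pi1 /pi2 /cpair -surjective_pairing Cantor.cancel_to_of. Qed.

Definition pi_cpair := (pi1_cpair, pi2_cpair).

(** * Effective functionals *)

(** The flag [o] permits access to the oracle, so that one set of closure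
    properties serves both the functionals of an oracle and the computable
    functions. *)
Definition effective (o : bool) (F : (nat -> nat) -> nat -> nat) : Prop :=
  exists2 e : code, o || oracle_free e & forall g n, eval g e n (F g n).

Notation effective_pred o P := (effective o (fun g n => nat_of_bool (P g n))).

Section Effective.
Variable o : bool.
Implicit Types (F G : (nat -> nat) -> nat -> nat).
Implicit Types (P Q : (nat -> nat) -> nat -> bool).

Lemma effective_ext F G :
  (forall g n, F g n = G g n) -> effective o F -> effective o G.
Proof. by move=> FG [e oe eF]; exists e => // g n; rewrite -FG. Qed.

Lemma effective_oracle : o -> effective o (fun g n => g n).
Proof. by move=> ho; exists Oracle => //; rewrite ho. Qed.

Lemma effective_pi1 F : effective o F -> effective o (fun g n => pi1 (F g n)).
Proof.
move=> [e oe eF]; exists (Comp Left e) => [|g n]; first by [].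
by exists (F g n).
Qed.

Lemma effective_pi2 F : effective o F -> effective o (fun g n => pi2 (F g n)).
Proof.
move=> [e oe eF]; exists (Comp Right e) => [|g n]; first by [].
by exists (F g n).
Qed.

Lemma effective_succ F : effective o F -> effective o (fun g n => (F g n).+1).
Proof.
move=> [e oe eF]; exists (Comp Succ e) => [|g n]; first by [].
by exists (F g n).
Qed.

Lemma effective_cpair F G : effective o F -> effective o G ->
  effective o (fun g n => cpair (F g n) (G g n)).
Proof.
move=> [a oa aF] [b ob bG]; exists (Pair a b) => [|g n] /=.
  by move: oa ob; case: (o) => //= -> ->.
by exists (F g n), (G g n).
Qed.

Lemma effective_id : effective o (fun _ n => n).
Proof.
apply: (@effective_ext (fun _ n => cpair (pi1 n) (pi2 n))) => [g n|].
  exact: cpair_pi.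
by exists (Pair Left Right) => [|g n]; [exact: orbT | exists (pi1 n), (pi2 n)].
Qed.

Lemma effective_const c : effective o (fun _ _ => c).
Proof.
elim: c => [|c]; last exact: effective_succ.
by exists Zero => //; exact: orbT.
Qed.

Lemma effective_comp F G : effective o F -> effective o G ->
  effective o (fun g n => F g (G g n)).
Proof.
move=> [a oa aF] [b ob bG]; exists (Comp a b) => [|g n] /=.
  by move: oa ob; case: (o) => //= -> ->.
by exists (G g n).
Qed.

(** Functions of several arguments are treated as functions of one environment
    made of nested pairs; this is the passage from the environment form to
    arbitrary arguments. *)
Lemma effective_comp2 (H : (nat -> nat) -> nat -> nat -> nat) F G :
  effective o (fun g w => H g (pi1 w) (pi2 w)) ->
  effective o F -> effective o G ->
  effective o (fun g n => H g (F g n) (G g n)).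
Proof.
move=> eH eF eG.
apply: effective_ext (effective_comp eH (effective_cpair eF eG)) => g n.
by rewrite !pi_cpair.
Qed.

Lemma effective_iteri F (G : (nat -> nat) -> nat -> nat -> nat -> nat) H :
  effective o F ->
  effective o (fun g w => G g (pi1 w) (pi1 (pi2 w)) (pi2 (pi2 w))) ->
  effective o H ->
  effective o (fun g n => iteri (F g n) (G g n) (H g n)).
Proof.
move=> eF [b ob bG] [a oa aH].
suff eP : effective o (fun g w => iteri (pi2 w) (G g (pi1 w)) (H g (pi1 w))).
  apply: effective_ext (effective_comp eP (effective_cpair effective_id eF)).
  by move=> g n; rewrite !pi_cpair.
exists (Prec a b) => [|g w] /=.
  by move: oa ob; case: (o) => //= -> ->.
rewrite -/(pi1 w) -/(pi2 w); elim: (pi2 w) => [|k IHk] //=.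
exists (iteri k (G g (pi1 w)) (H g (pi1 w))) => //.
by have := bG g (cpair (pi1 w) (cpair k (iteri k (G g (pi1 w)) (H g (pi1 w)))));
  rewrite !pi_cpair.
Qed.

End Effective.

Ltac effective_basics :=
  repeat first
    [ assumption | exact: effective_id
    | apply: effective_pi1 | apply: effective_pi2
    | apply: effective_cpair | apply: effective_succ
    | exact: effective_const ].

Section Arithmetic.
Variable o : bool.
Implicit Types (F G : (nat -> nat) -> nat -> nat).
Implicit Types (P Q : (nat -> nat) -> nat -> bool).

Lemma effective_add F G : effective o F -> effective o G ->
  effective o (fun g n => F g n + G g n).
Proof.
move=> eF eG.
apply: (@effective_ext _ (fun g n => iteri (F g n) (fun _ r => r.+1) (G g n))).
  by move=> g n; elim: (F g n) => //= k ->.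
by apply: effective_iteri; effective_basics.
Qed.

Lemma effective_mul F G : effective o F -> effective o G ->
  effective o (fun g n => F g n * G g n).
Proof.
move=> eF eG.
apply: (@effective_ext _ (fun g n => iteri (F g n) (fun _ r => G g n + r) 0)).
  by move=> g n; elim: (F g n) => //= k ->; rewrite mulSn.
apply: effective_iteri; effective_basics; apply: effective_add; effective_basics.
by apply: effective_comp; effective_basics.
Qed.

Lemma effective_pred_nat F : effective o F -> effective o (fun g n => (F g n).-1).
Proof.
move=> eF.
apply: (@effective_ext _ (fun g n => iteri (F g n) (fun k _ => k) 0)).
  by move=> g n; case: (F g n).
by apply: effective_iteri; effective_basics.
Qed.

Lemma effective_sub F G : effective o F -> effective o G ->
  effective o (fun g n => F g n - G g n).
Proof.
move=> eF eG.
apply: (@effective_ext _ (fun g n => iteri (G g n) (fun _ r => r.-1) (F g n))).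
  by move=> g n; elim: (G g n) => [|k /= ->]; rewrite ?subn0 ?subnS.
by apply: effective_iteri; effective_basics; apply: effective_pred_nat; effective_basics.
Qed.

Lemma effective_not P : effective_pred o P ->
  effective_pred o (fun g n => ~~ P g n).
Proof.
move=> eP; apply: (@effective_ext _ (fun g n => 1 - P g n)).
  by move=> g n; case: (P g n).
by apply: effective_sub; effective_basics.
Qed.

Lemma effective_and P Q : effective_pred o P -> effective_pred o Q ->
  effective_pred o (fun g n => P g n && Q g n).
Proof.
move=> eP eQ; apply: (@effective_ext _ (fun g n => P g n * Q g n)).
  by move=> g n; rewrite mulnb.
exact: effective_mul.
Qed.

Lemma effective_or P Q : effective_pred o P -> effective_pred o Q ->
  effective_pred o (fun g n => P g n || Q g n).
Proof.
move=> eP eQ.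
apply: (@effective_ext _ (fun g n => ~~ (~~ P g n && ~~ Q g n))).
  by move=> g n; case: (P g n) (Q g n) => [] [].
by apply: effective_not; apply: effective_and; apply: effective_not.
Qed.

Lemma effective_leq F G : effective o F -> effective o G ->
  effective_pred o (fun g n => F g n <= G g n).
Proof.
move=> eF eG.
apply: (@effective_ext _ (fun g n => 1 - (F g n - G g n))).
  by move=> g n; rewrite /leq; case: (F g n - G g n).
by apply: effective_sub; effective_basics; apply: effective_sub.
Qed.

Lemma effective_eqn F G : effective o F -> effective o G ->
  effective_pred o (fun g n => F g n == G g n).
Proof.
move=> eF eG.
apply: (@effective_ext _ (fun g n => (F g n <= G g n) && (G g n <= F g n))).
  by move=> g n; rewrite eqn_leq.
by apply: effective_and; apply: effective_leq.
Qed.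

Lemma effective_eqb P Q : effective_pred o P -> effective_pred o Q ->
  effective_pred o (fun g n => P g n == Q g n).
Proof.
move=> eP eQ.
apply: (@effective_ext _ (fun g n => (nat_of_bool (P g n) == Q g n))).
  by move=> g n; case: (P g n) (Q g n) => [] [].
exact: effective_eqn.
Qed.

Lemma effective_sum F (H : (nat -> nat) -> nat -> nat -> nat) :
  effective o F -> effective o (fun g w => H g (pi1 w) (pi2 w)) ->
  effective o (fun g n => \sum_(0 <= k < F g n) H g n k).
Proof.
move=> eF eH.
apply: (@effective_ext _ (fun g n => iteri (F g n) (fun k r => r + H g n k) 0)).
  move=> g n; elim: (F g n) => [|k /= ->]; first by rewrite big_nil.
  by rewrite big_nat_recr.
apply: effective_iteri; effective_basics; apply: effective_add; effective_basics.
by apply: effective_comp2; effective_basics.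
Qed.

Lemma effective_count F (B : (nat -> nat) -> nat -> nat -> bool) :
  effective o F -> effective_pred o (fun g w => B g (pi1 w) (pi2 w)) ->
  effective o (fun g n => count (B g n) (iota 0 (F g n))).
Proof.
move=> eF eB.
apply: (@effective_ext _ (fun g n => \sum_(0 <= k < F g n) B g n k)).
  by move=> g n; rewrite -sumn_count /index_iota subn0 sumnE big_map.
exact: (@effective_sum F (fun g n k => B g n k)).
Qed.

Lemma effective_all F (B : (nat -> nat) -> nat -> nat -> bool) :
  effective o F -> effective_pred o (fun g w => B g (pi1 w) (pi2 w)) ->
  effective_pred o (fun g n => all (B g n) (iota 0 (F g n))).
Proof.
move=> eF eB.
apply: (@effective_ext _ (fun g n => count (B g n) (iota 0 (F g n)) == F g n)).
  by move=> g n; rewrite all_count size_iota.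
by apply: effective_eqn => //; apply: effective_count.
Qed.

Lemma effective_has F (B : (nat -> nat) -> nat -> nat -> bool) :
  effective o F -> effective_pred o (fun g w => B g (pi1 w) (pi2 w)) ->
  effective_pred o (fun g n => has (B g n) (iota 0 (F g n))).
Proof.
move=> eF eB.
apply: (@effective_ext _ (fun g n => 0 < count (B g n) (iota 0 (F g n)))).
  by move=> g n; rewrite has_count.
by apply: effective_leq; [effective_basics | apply: effective_count].
Qed.

End Arithmetic.

(** The unbounded search need not be a total operation: the search converges
    for those oracles for which it always succeeds. *)
Lemma effective_search o (P : (nat -> nat) -> nat -> nat -> bool) :
  effective_pred o (fun g w => P g (pi1 w) (pi2 w)) ->
  exists2 c : code, o || oracle_free c &
    forall g (H : forall z, exists y, P g z y) z, eval g c z (ex_minn (H z)).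
Proof.
move=> /effective_not [c oc cP]; exists (Mu c) => // g H z /=.
case: ex_minnP => m Pzm min_m; split=> [|j ltjm].
  by have := cP g (cpair z m); rewrite !pi_cpair Pzm.
exists 0; have := cP g (cpair z j); rewrite !pi_cpair.
by case: (boolP (P g z j)) => // /min_m; rewrite leqNgt ltjm.
Qed.

(** A hook, extended below to the functions introduced there. *)
Ltac effective_more := fail.

Ltac effective_step :=
  lazymatch goal with
  | |- effective _ (fun _ _ => ?c) => exact: effective_const
  | |- effective _ (fun _ n => n) => exact: effective_id
  | |- effective _ (fun g n => pi1 _) => apply: effective_pi1
  | |- effective _ (fun g n => pi2 _) => apply: effective_pi2
  | |- effective _ (fun g n => cpair _ _) => apply: effective_cpair
  | |- effective _ (fun g n => S _) => apply: effective_succ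
  | |- effective _ (fun g n => _ + _) => apply: effective_add
  | |- effective _ (fun g n => _ * _) => apply: effective_mul
  | |- effective _ (fun g n => _ - _) => apply: effective_sub
  | |- effective _ (fun g n => _.-1) => apply: effective_pred_nat
  | |- effective _ (fun g n => nat_of_bool (_ && _)) => apply: effective_and
  | |- effective _ (fun g n => nat_of_bool (_ || _)) => apply: effective_or
  | |- effective _ (fun g n => nat_of_bool (~~ _)) => apply: effective_not
  | |- effective _ (fun g n => nat_of_bool (_ <= _)) => apply: effective_leq
  | |- effective _ (fun g n => nat_of_bool (@eq_op Datatypes_nat__canonical__eqtype_Equality _ _)) =>
      apply: effective_eqn
  | |- effective _ (fun g n => nat_of_bool (@eq_op Datatypes_bool__canonical__eqtype_Equality _ _)) =>
      apply: effective_eqb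
  | |- effective _ (fun g n => nat_of_bool (all _ _)) => apply: effective_all
  | |- effective _ (fun g n => nat_of_bool (has _ _)) => apply: effective_has
  | |- effective _ (fun g n => count _ _) => apply: effective_count
  | |- effective _ (fun g n => iteri _ _ _) => apply: effective_iteri
  | |- _ => effective_more
  end.

(** Closes goals on a parameter that has been moved under a binder, where the
    environment has become a projection of a larger one. *)
Ltac effective_var :=
  match goal with
  | H : effective _ ?E |- effective _ (fun g n => ?E g (@?t g n)) =>
      apply: (@effective_comp _ E t H)
  end.

Ltac effectively :=
  repeat first [assumption | effective_var | progress effective_step].

(** * Finite sets as binary expansions *)

Definition bit (m n : nat) : bool := odd (iter n half m).

Definition pack (p : pred nat) (n : nat) : nat := \sum_(0 <= k < n) p k * 2 ^ k.

Lemma bit0 n : bit 0 n = false.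
Proof. by rewrite /bit; elim: n => //= n IHn; rewrite -iterS iterSr. Qed.

Lemma packS p n : pack p n.+1 = p 0 + (pack (fun k => p k.+1) n).*2.
Proof.
rewrite /pack big_nat_recl // expn0 muln1 -mul2n big_distrr /=.
by congr (_ + _); apply: eq_bigr => k _; rewrite expnS mulnCA.
Qed.

Lemma bit_pack p n k : bit (pack p n) k = (k < n) && p k.
Proof.
elim: n p k => [|n IHn] p k; first by rewrite /pack big_nil bit0.
rewrite packS /bit; case: k => [|k]; first by rewrite /= oddD odd_double addbF oddb.
by rewrite iterSr half_bit_double -[odd _]/(bit _ k) IHn.
Qed.

Lemma effective_bit o F G : effective o F -> effective o G ->
  effective_pred o (fun g n => bit (F g n) (G g n)).
Proof.
(* parity and halving are obtained by recursion and by counting odd numbers *)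
have odd_iteri m : nat_of_bool (odd m) = iteri m (fun _ r => 1 - r) 0.
  by elim: m => //= m <-; case: (odd m).
have half_count m : half m = count odd (iota 0 m).
  elim: m => // m IHm; rewrite -addn1 iotaD count_cat -IHm /= add0n addn0 addn1.
  by rewrite -uphalfE uphalf_half addnC.
move=> eF eG.
apply: (@effective_ext _ (fun g n =>
  iteri (iteri (G g n) (fun _ r => count (fun m => iteri m (fun _ r => 1 - r) 0 == 1)
    (iota 0 r)) (F g n)) (fun _ r => 1 - r) 0)).
  move=> g n; rewrite /bit odd_iteri; congr (iteri _ _ _).
  elim: (G g n) => //= k ->; rewrite half_count; apply: eq_count => m.
  by rewrite -odd_iteri; case: (odd m).
by effectively.
Qed.

Lemma effective_pack o F (B : (nat -> nat) -> nat -> nat -> bool) :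
  effective o F -> effective_pred o (fun g w => B g (pi1 w) (pi2 w)) ->
  effective o (fun g n => pack (B g n) (F g n)).
Proof.
move=> eF eB; apply: effective_sum => //; effectively.
apply: (@effective_ext _ (fun g n => iteri (pi2 n) (fun _ r => 2 * r) 1)).
  by move=> g n; elim: (pi2 n) => //= k ->; rewrite expnS.
by effectively.
Qed.

Ltac effective_more ::=
  lazymatch goal with
  | |- effective _ (fun g n => nat_of_bool (bit _ _)) => apply: effective_bit
  | |- effective _ (fun g n => pack _ _) => apply: effective_pack
  end.

(** * Staged evaluation of oracle-free codes *)

Fixpoint num (c : code) : nat :=
  match c with
  | Zero => cpair 0 0
  | Succ => cpair 1 0
  | Left => cpair 2 0
  | Right => cpair 3 0
  | Oracle => cpair 4 0
  | Pair a b => cpair 5 (cpair (num a) (num b))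
  | Comp a b => cpair 6 (cpair (num a) (num b))
  | Prec a b => cpair 7 (cpair (num a) (num b))
  | Mu a => cpair 8 (num a)
  end.

(** [T] is a set of triples <e, <x, y>>, each recording that program number
    [e] outputs [y] on input [x]. *)
Definition known (T e x y : nat) : bool := bit T (cpair e (cpair x y)).

(** One inference step of the operational semantics, the premises being taken
    from [T] and the intermediate values below [s].  Numbers that code no
    program may get outputs too; the argument uses only that these outputs are
    enumerated monotonically.  The tag 4 of [Oracle] gets none. *)
Definition justified (T s e x y : nat) : bool :=
  let a := pi1 (pi2 e) in
  let b := pi2 (pi2 e) in
  [|| (pi1 e == 0) && (y == 0),
      (pi1 e == 1) && (y == x.+1),
      (pi1 e == 2) && (y == pi1 x),
      (pi1 e == 3) && (y == pi2 x),
      [&& pi1 e == 5, known T a x (pi1 y) & known T b x (pi2 y)],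
      (pi1 e == 6) &&
        has (fun u => known T b x u && known T a u y) (iota 0 s),
      [&& pi1 e == 7, pi2 x == 0 & known T a (pi1 x) y],
      [&& pi1 e == 7, 0 < pi2 x &
        has (fun r => known T e (cpair (pi1 x) (pi2 x).-1) r &&
                      known T b (cpair (pi1 x) (cpair (pi2 x).-1 r)) y)
            (iota 0 s)]
    | [&& pi1 e == 8, known T (pi2 e) (cpair x y) 0 &
        all (fun j => has (fun v => known T (pi2 e) (cpair x j) v.+1) (iota 0 s))
            (iota 0 y)]].

(** The conclusions at stage [s] are kept below [s], so that they form a
    finite set. *)
Fixpoint stage (s : nat) : nat :=
  if s is s'.+1 then
    pack (fun n => bit (stage s') n ||
                   justified (stage s') s' (pi1 n) (pi1 (pi2 n)) (pi2 (pi2 n))) s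
  else 0.

Definition derived (e x y s : nat) : bool := known (stage s) e x y.

Lemma effective_stage o F : effective o F -> effective o (fun g n => stage (F g n)).
Proof.
move=> eF; apply: (@effective_ext _ (fun g n => iteri (F g n) (fun s T =>
   pack (fun n => bit T n ||
                  justified T s (pi1 n) (pi1 (pi2 n)) (pi2 (pi2 n))) s.+1) 0)).
  by move=> g n; elim: (F g n) => //= s ->.
by rewrite /justified /known; effectively.
Qed.

Lemma effective_derived o E X Y S : effective o E -> effective o X ->
  effective o Y -> effective o S ->
  effective_pred o (fun g n => derived (E g n) (X g n) (Y g n) (S g n)).
Proof.
by move=> *; rewrite /derived /known; effectively; apply: effective_stage.
Qed.

Lemma derivedS e x y s : derived e x y s.+1 =
  (cpair e (cpair x y) < s.+1) &&
  (derived e x y s || justified (stage s) s e x y).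
Proof. by rewrite /derived /known bit_pack !pi_cpair. Qed.

Lemma derived_mono e x y s t : s <= t -> derived e x y s -> derived e x y t.
Proof.
move=> /subnK <-; elim: (t - s) => // k IHk /IHk.
rewrite addSn derivedS => d; rewrite d andbT.
case: (k + s) d => [|u]; first by rewrite /derived /known bit0.
by rewrite derivedS => /andP[/leqW].
Qed.

Lemma derived_sound g c x y s :
  oracle_free c -> derived (num c) x y s -> eval g c x y.
Proof.
elim: s c x y => [|s IHs] c x y oc; first by rewrite /derived /known bit0.
rewrite derivedS => /andP[_ /orP[/(IHs _ _ _ oc)//|]].
case: c oc => [||||//|a b|a b|a b|a] oc;
  rewrite /justified [num _]/= !pi_cpair //= ?orbF.
- by move=> /eqP.
- by move=> /eqP.
- by move=> /eqP.
- by move=> /eqP.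
- case/andP: oc => oa ob /andP[/(IHs _ _ _ oa) ea /(IHs _ _ _ ob) eb].
  by exists (pi1 y), (pi2 y); rewrite cpair_pi.
- case/andP: oc => oa ob /hasP[u _ /andP[/(IHs _ _ _ ob) eb /(IHs _ _ _ oa) ea]].
  by exists u.
- rewrite -/(pi1 x) -/(pi2 x); move: (oc) => /andP[oa ob].
  case: (pi2 x) => [|k]; first by rewrite orbF => /(IHs _ _ _ oa).
  move=> /hasP[r _ /andP[er /(IHs _ _ _ ob) eb]]; exists r => //.
  have /(IHs _ _ _ oc) : derived (num (Prec a b)) (cpair (pi1 x) k) r s by [].
  by rewrite /= -/(pi1 _) -/(pi2 _) !pi_cpair.
- move=> /andP[/(IHs a _ _ oc) e0 /allP lt]; split=> // j ltj.
  have /lt/hasP[v _ /(IHs a _ _ oc) ev] : j \in iota 0 y by rewrite mem_iota.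
  by exists v.
Qed.

Definition eventually (P : nat -> Prop) : Prop := exists s, forall t, s <= t -> P t.

Lemma eventually_and (P Q : nat -> Prop) :
  eventually P -> eventually Q -> eventually (fun s => P s /\ Q s).
Proof.
move=> [s Ps] [t Qt]; exists (maxn s t) => u; rewrite geq_max => /andP[su tu].
by split; [apply: Ps | apply: Qt].
Qed.

Lemma eventually_all (r : seq nat) (P : nat -> nat -> Prop) :
  (forall k, k \in r -> eventually (P k)) ->
  eventually (fun s => forall k, k \in r -> P k s).
Proof.
elim: r => [|k r IHr] H; first by exists 0.
have [|s Hs] := @eventually_and (P k) (fun s => forall k, k \in r -> P k s)
  (H k (mem_head _ _)).
  by apply: IHr => j jr; apply: H; rewrite inE jr orbT.
exists s => t /Hs[Pk Pr] j; rewrite inE => /predU1P[->//|].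
exact: Pr.
Qed.

Lemma eventually_gt n : eventually (fun s => n < s).
Proof. by exists n.+1. Qed.

Lemma eventually_imp (P Q : nat -> Prop) :
  (forall s, P s -> Q s) -> eventually P -> eventually Q.
Proof. by move=> PQ [s Ps]; exists s => t /Ps/PQ. Qed.

(** Each output is derived from finitely many outputs of the immediate
    subprograms, or of the same program at a smaller recursion argument, hence
    one stage after these have all appeared. *)
Lemma derived_complete g c x y :
  oracle_free c -> eval g c x y -> eventually (derived (num c) x y).
Proof.
(* one further stage performs the inference; its bound must exceed the triple *)
have step e x' y' : eventually (fun s => justified (stage s) s e x' y') ->
    eventually (derived e x' y').
  move=> /(eventually_and (eventually_gt (cpair e (cpair x' y')))) [s Hs].
  have [lts js] := Hs s (leqnn _).
  exists s.+1 => t st; apply: derived_mono st _.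
  by rewrite derivedS js orbT andbT leqW.
elim: c x y => [||||//|a IHa b IHb|a IHa b IHb|a IHa b IHb|a IHa] x y oc.
1-4: by move=> /= ->; apply: step; exists 0 => s _;
  rewrite /justified /num !pi_cpair /= ?eqxx.
- case/andP: oc => oa ob /= [u [v [/(IHa _ _ oa) ea /(IHb _ _ ob) eb ->]]].
  apply: step; apply: eventually_imp (eventually_and ea eb) => s [au bv].
  by rewrite /justified !pi_cpair /= orbF; apply/andP.
- case/andP: oc => oa ob /= [u /(IHb _ _ ob) eb /(IHa _ _ oa) ea].
  apply: step; apply: eventually_imp
    (eventually_and (eventually_gt u) (eventually_and ea eb)) => s [us [au bv]].
  rewrite /justified !pi_cpair /= orbF; apply/hasP; exists u.
    by rewrite mem_iota.
  by apply/andP.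
- move: (oc) => /andP[oa ob]; rewrite -[in derived _ x](cpair_pi x).
  rewrite [eval _ _ x y]/= -/(pi1 x) -/(pi2 x).
  elim: (pi2 x) y => [|k IHk] y /=.
    move=> /(IHa _ _ oa) ea; apply: step; apply: eventually_imp ea => s ea.
    by rewrite /justified !pi_cpair /= !orbF.
  move=> [r /IHk er /(IHb _ _ ob) eb]; apply: step.
  apply: eventually_imp
    (eventually_and (eventually_gt r) (eventually_and er eb)) => s [rs [sr sb]].
  rewrite /justified !pi_cpair /= orbF; apply/hasP; exists r.
    by rewrite mem_iota.
  by apply/andP.
- move=> /= [/(IHa _ _ oc) e0 lt]; apply: step.
  have /eventually_all ej : forall j, j \in iota 0 y -> eventually (fun s =>
      has (fun v => known (stage s) (num a) (cpair x j) v.+1) (iota 0 s)).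
    move=> j; rewrite mem_iota => /lt[v /(IHa _ _ oc) ev].
    apply: eventually_imp (eventually_and (eventually_gt v) ev) => s [vs sv].
    by apply/hasP; exists v; rewrite ?mem_iota.
  apply: eventually_imp (eventually_and e0 ej) => s [s0 sj].
  rewrite /justified !pi_cpair /=; by apply/andP; split=> //; apply/allP.
Qed.

(** * Blocks, large sets and refutations *)

(** Bounding the output by the stage turns a bound for the stage into a bound
    for the value. *)
Definition converged (e x s : nat) : bool :=
  has (fun y => derived e x y s) (iota 0 s).

(** Counting convergent initial segments, rather than convergent arguments,
    makes this bounded when [e] diverges somewhere.  The level sets of
    [reach e] are the blocks of [e]. *)
Definition reach (e s : nat) : nat :=
  count (fun y => all (fun z => converged e z s) (iota 0 y.+1)) (iota 0 s).

Definition marked (e i t w : nat) : bool :=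
  (reach e w == reach e t) && derived i w 1 t.

(** Two elements more than the 2i that the indices below [i] may have used up
    when the sets are split. *)
Definition large (e i t : nat) : bool :=
  i.*2.+1 < count (marked e i t) (iota 0 t).

Definition in_string (g : nat -> nat) (l m w : nat) : bool :=
  all (fun i => (g (cpair w i) == 1) == bit m i) (iota 0 l).

(** The witness [r] is <l, <m, N>>, where the string has length [l] and the
    first [l] binary digits of [m] as its entries, and [N] bounds the tail from
    below. *)
Definition in_tail (g : nat -> nat) (r w : nat) : bool :=
  (pi2 (pi2 r) <= w) && in_string g (pi1 r) (pi1 (pi2 r)) w.

Definition refuted (g : nat -> nat) (e r s : nat) : bool :=
  has (fun t => has (fun i => large e i t &&
      all (fun w => ~~ marked e i t w || in_tail g r w) (iota 0 t)) (iota 0 t))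
    (iota 0 s).

Definition halted (g : nat -> nat) (x s : nat) : bool :=
  (x <= s) && all (fun q => converged (pi1 q) x s || refuted g (pi1 q) (pi2 q) s)
                  (iota 0 x).

Definition splits (m e i t : nat) : bool :=
  has (fun w => marked e i t w && bit m w) (iota 0 t) &&
  has (fun w => marked e i t w && ~~ bit m w) (iota 0 t).

(** A condition on <S, m> saying that the finite set [m] splits all large sets
    of block [v] of [e], the stage [S] lying beyond this block.  It is decidable,
    so that a splitting set can be found by search. *)
Definition splitting_mask (e v p : nat) : bool :=
  (v < reach e (pi1 p)) &&
  all (fun t => all (fun i => ~~ ((reach e t == v) && large e i t) ||
                              splits (pi2 p) e i t) (iota 0 t))
      (iota 0 (pi1 p)).

(** * Effectiveness of the refutation test *)

Section EffectiveBlocks.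
Variable o : bool.
Implicit Types E I X S T W M : (nat -> nat) -> nat -> nat.

Lemma effective_converged E X S :
  effective o E -> effective o X -> effective o S ->
  effective_pred o (fun g n => converged (E g n) (X g n) (S g n)).
Proof.
move=> eE eX eS; rewrite /converged; effectively.
by apply: effective_derived; effectively.
Qed.

Lemma effective_reach E S :
  effective o E -> effective o S ->
  effective o (fun g n => reach (E g n) (S g n)).
Proof.
move=> eE eS; rewrite /reach; effectively.
by apply: effective_converged; effectively.
Qed.

Lemma effective_marked E I T W :
  effective o E -> effective o I -> effective o T -> effective o W ->
  effective_pred o (fun g n => marked (E g n) (I g n) (T g n) (W g n)).
Proof.
move=> eE eI eT eW; rewrite /marked; effectively.
- exact: effective_reach.
- exact: effective_reach.
- by apply: effective_derived; effectively.
Qed.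

Lemma effective_large E I T :
  effective o E -> effective o I -> effective o T ->
  effective_pred o (fun g n => large (E g n) (I g n) (T g n)).
Proof.
move=> eE eI eT.
apply: (@effective_ext _ (fun g n => (2 * I g n).+1 <
  count (marked (E g n) (I g n) (T g n)) (iota 0 (T g n)))).
  by move=> g n; rewrite mul2n.
effectively.
by apply: effective_marked; effectively.
Qed.

End EffectiveBlocks.

Ltac effective_more ::=
  lazymatch goal with
  | |- effective _ (fun g n => nat_of_bool (bit _ _)) => apply: effective_bit
  | |- effective _ (fun g n => reach _ _) => apply: effective_reach
  | |- effective _ (fun g n => nat_of_bool (converged _ _ _)) =>
      apply: effective_converged
  | |- effective _ (fun g n => nat_of_bool (marked _ _ _ _)) =>
      apply: effective_marked
  | |- effective _ (fun g n => nat_of_bool (large _ _ _)) =>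
      apply: effective_large
  end.

Lemma effective_splitting_mask e :
  effective_pred false (fun _ w => splitting_mask e (pi1 w) (pi2 w)).
Proof. by rewrite /splitting_mask /splits; effectively. Qed.

Lemma effective_halted : effective_pred true (fun g w => halted g (pi1 w) (pi2 w)).
Proof.
have eO := @effective_oracle true isT.
rewrite /halted /refuted /in_tail /in_string; effectively.
by apply: (effective_comp eO); effectively.
Qed.

(** * Finiteness and growth of the blocks *)

Lemma converged_mono e x s t : s <= t -> converged e x s -> converged e x t.
Proof.
move=> st /hasP[y]; rewrite mem_iota => /= ys dy; apply/hasP; exists y.
  by rewrite mem_iota /= (leq_trans ys).
exact: derived_mono st dy.
Qed.

Lemma has_iota_mono (p : pred nat) s t :
  s <= t -> has p (iota 0 s) -> has p (iota 0 t).
Proof.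
move=> st /hasP[y]; rewrite mem_iota => /= ys py; apply/hasP; exists y => //.
by rewrite mem_iota /= (leq_trans ys).
Qed.

Lemma count_iota_mono (p q : pred nat) s t : s <= t -> subpred p q ->
  count p (iota 0 s) <= count q (iota 0 t).
Proof.
move=> /subnK <- pq; rewrite addnC iotaD count_cat.
exact: leq_trans (sub_count pq _) (leq_addr _ _).
Qed.

Lemma reach_mono e s t : s <= t -> reach e s <= reach e t.
Proof.
move=> st; apply: count_iota_mono => // y; apply: sub_all => z.
exact: converged_mono.
Qed.

Lemma reach_unbounded e v :
  (forall x, exists s, converged e x s) -> exists s, v < reach e s.
Proof.
move=> tot.
have /eventually_all[s Hs] : forall y, y \in iota 0 v.+1 ->
    eventually (fun s => converged e y s).
  move=> y _; have [s cs] := tot y; exists s => t st.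
  exact: converged_mono st cs.
have [conv ltvu] := (Hs _ (leq_maxl s v.+1), leq_maxr s v.+1).
move: (maxn s v.+1) conv ltvu => u conv ltvu.
exists u; rewrite -[v.+1](size_iota 0) /reach -size_filter.
apply: uniq_leq_size (iota_uniq _ _) _ => y.
rewrite mem_filter !mem_iota !add0n !leq0n !andTb => yv.
rewrite (leq_trans yv ltvu) andbT.
by apply/allP => z; rewrite mem_iota => zy; apply: conv; rewrite mem_iota; lia.
Qed.

(** A divergence at [x] bounds the reach by [x], and a bounded monotone
    sequence of numbers is eventually constant: the last block is cofinite. *)
Lemma reach_stabilizes e x : (forall s, ~~ converged e x s) ->
  exists b, forall t, b <= t -> reach e t = reach e b.
Proof.
move=> div.
have bound s : reach e s <= x.
  rewrite /reach -[leqRHS](size_iota 0) -size_filter.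
  apply: uniq_leq_size (filter_uniq _ (iota_uniq _ _)) _ => y.
  rewrite mem_filter mem_iota => /andP[/allP conv _]; rewrite mem_iota /=.
  rewrite ltnNge; apply/negP => xy; have /negP := div s; apply; apply: conv.
  by rewrite mem_iota.
case: (@ex_maxnP (fun n => `[< exists s, reach e s = n >]) x).
- by exists (reach e 0); apply/asboolP; exists 0.
- by move=> n /asboolP[s <-].
move=> m /asboolP[b <-] max_b; exists b => t bt.
apply/eqP; rewrite eqn_leq (reach_mono e bt) andbT.
by apply: max_b; apply/asboolP; exists t.
Qed.

Lemma marked_mono e i t t' : t <= t' -> reach e t = reach e t' ->
  subpred (marked e i t) (marked e i t').
Proof.
move=> tt' rt w /andP[/eqP rw d]; rewrite /marked rw rt eqxx /=.
exact: derived_mono tt' d.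
Qed.

Lemma splits_mono m e i t t' : t <= t' -> reach e t = reach e t' ->
  splits m e i t -> splits m e i t'.
Proof.
move=> tt' rt /andP[ha hb]; rewrite /splits.
rewrite (has_iota_mono tt' (sub_has _ ha)) ?(has_iota_mono tt' (sub_has _ hb)) //.
- by move=> w /andP[/(marked_mono tt' rt) -> ->].
- by move=> w /andP[/(marked_mono tt' rt) -> ->].
Qed.

(** * Splitting the large sets *)

Lemma fresh_element (D U : seq nat) : uniq D -> size U < size D ->
  exists2 d, d \in D & d \notin U.
Proof.
move=> uD; rewrite ltnNge => /negP UD.
have [/allP DU|/allPn[d dD dU]] := boolP (all (mem U) D); last by exists d.
by case: UD; apply: uniq_leq_size.
Qed.

(** Greedy choice: when the set number [i] is treated, at most [i] red and [i]
    blue elements have been chosen, so it contains two unused ones. *)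
Lemma two_colouring (n : nat) (active : pred nat) (D : nat -> seq nat) :
  (forall i, i < n -> active i -> uniq (D i) /\ i.*2.+1 < size (D i)) ->
  exists red : seq nat, forall i, i < n -> active i ->
    has (mem red) (D i) && has (predC (mem red)) (D i).
Proof.
move=> large_D.
suff [red [blue [_ _ disj H]]] : exists red blue : seq nat,
    [/\ size red <= n, size blue <= n, (forall d, d \in red -> d \notin blue) &
     forall i, i < n -> active i -> has (mem red) (D i) && has (mem blue) (D i)].
  exists red => i lt_in act_i; have /andP[-> /sub_has] := H i lt_in act_i.
  by apply=> d /= db; apply/negP => /disj; rewrite db.
elim: n large_D => [|n IHn] large_D; first by exists [::], [::].
have [|red [blue [sr sb disj H]]] := IHn.
  by move=> i lt_in; apply: large_D; apply: leqW.
have [act_n|idle_n] := boolP (active n); last first.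
  exists red, blue; split; rewrite ?leqW // => i.
  by rewrite ltnS leq_eqVlt => /predU1P[->|/H//]; rewrite (negPf idle_n).
have [uD sD] := large_D n (leqnn _) act_n.
have [|a aD] := @fresh_element (D n) (red ++ blue) uD.
  by rewrite size_cat; lia.
rewrite mem_cat negb_or => /andP[ar ab].
have [|b bD] := @fresh_element (D n) (a :: red ++ blue) uD.
  by rewrite /= size_cat; lia.
rewrite inE mem_cat !negb_or => /and3P[ba br bb].
exists (a :: red), (b :: blue); split; rewrite ?ltnS //.
  move=> d; rewrite !inE negb_or => /predU1P[->|dr]; first by rewrite eq_sym ba.
  by rewrite disj // andbT; apply: contraNneq br => <-.
move=> i; rewrite ltnS leq_eqVlt => /predU1P[->|lt_in] act_i.
  by apply/andP; split; apply/hasP; [exists a | exists b]; rewrite ?inE ?eqxx.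
have /andP[hr hb] := H i lt_in act_i.
by apply/andP; split; [apply: sub_has hr | apply: sub_has hb] => d;
  rewrite /= inE => ->; rewrite orbT.
Qed.

(** Within a block the sets marked for [i] grow with the stage.  So it is enough
    to split, for each [i], the first one that is large. *)
Lemma splitting_mask_exists e v :
  (forall x, exists s, converged e x s) -> exists p, splitting_mask e v p.
Proof.
move=> /(reach_unbounded v)[S ltvS].
pose cand i t := [&& t < S, reach e t == v & large e i t].
pose active i := has (cand i) (iota 0 S).
pose first_ i := find (cand i) (iota 0 S).
have first_P i : active i -> cand i (first_ i).
  move=> ai; have := nth_find 0 ai; rewrite nth_iota ?add0n //.
  by move: ai; rewrite /active has_find size_iota.
have first_min i t : cand i t -> first_ i <= t.
  move=> ct; rewrite leqNgt; apply/negP => lt.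
  have /andP[tS _] := ct.
  by have := before_find 0 lt; rewrite nth_iota // add0n ct.
have [|red redP] := @two_colouring S active
  (fun i => [seq w <- iota 0 (first_ i) | marked e i (first_ i) w]).
  move=> i _ /first_P/and3P[_ _ lg]; split.
    by rewrite filter_uniq // iota_uniq.
  by rewrite size_filter.
exists (cpair S (pack (mem red) S)); rewrite /splitting_mask !pi_cpair ltvS /=.
apply/allP => t; rewrite mem_iota /= => tS.
apply/allP => i; rewrite mem_iota /= => it.
rewrite -implybE; apply/implyP => /andP[/eqP rt lg].
have ct : cand i t by rewrite /cand tS rt eqxx.
have ai : active i by apply/hasP; exists t => //; rewrite mem_iota.
have /and3P[fS /eqP rf _] := first_P i ai.
apply: (@splits_mono _ _ _ (first_ i)); [exact: first_min | by rewrite rf rt | ].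
have /andP[/hasP[a] + ra /hasP[b] + rb] := redP i (ltn_trans it tS) ai.
rewrite !mem_filter !mem_iota /= => /andP[ma af] /andP[mb bf].
apply/andP; split; apply/hasP; [exists a | exists b]; rewrite ?mem_iota //.
  by rewrite ma bit_pack (ltn_trans af).
by rewrite mb bit_pack (ltn_trans bf).
Qed.

(** The sets found for the single blocks are glued together; an element learns
    its own block from its reach. *)
Lemma splitting_set e : (forall x, exists s, converged e x s) ->
  exists2 R : set nat, computable_set R &
    forall i t, i < t -> large e i t ->
      (exists2 a, a < t & marked e i t a /\ R a) /\
      (exists2 a, a < t & marked e i t a /\ ~ R a).
Proof.
move=> tot; pose H v := splitting_mask_exists v tot.
pose mask v := pi2 (ex_minn (H v)).
exists [set w | bit (mask (reach e w)) w].
  have [c oc cP] := @effective_search false (fun _ => splitting_mask e)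
    (effective_splitting_mask e).
  have eH : effective false (fun _ v => ex_minn (H v)) by exists c.
  suff : effective_pred false (fun _ w => bit (mask (reach e w)) w).
    apply: effective_ext => g w; congr nat_of_bool.
    by apply/idP/idP => [/mem_set//|/set_mem].
  rewrite /mask; effectively; apply: (effective_comp eH); effectively.
move=> i t it lg; rewrite /mask.
have : splits (mask (reach e t)) e i t.
  rewrite /mask; case: ex_minnP => p /andP[rp /allP Hp] _.
  have tp : t < pi1 p.
    by rewrite ltnNge; apply/negP => /(reach_mono e); rewrite leqNgt rp.
  have /Hp/allP/(_ i) : t \in iota 0 (pi1 p) by rewrite mem_iota.
  by rewrite mem_iota eqxx lg => /(_ it).
by case/andP => /hasP[a]; rewrite mem_iota => /= at_ /andP[ma ba]
  /hasP[a']; rewrite mem_iota => /= at' /andP[ma' ba'];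
  split; [exists a | exists a'] => //; split=> //=;
  [move: ma => /andP[/eqP -> _] | move: ma' => /andP[/eqP -> _]; apply/negP].
Qed.

(** * Witnesses from an independent sequence *)

Lemma in_stringP X l m w :
  reflect (string_set (column X) (mkseq (bit m) l) w)
          (in_string (char_fun X) l m w).
Proof.
apply: (iffP allP) => [H i /=|H i]; rewrite ?size_mkseq.
  move=> il; have := H i; rewrite mem_iota => /(_ il); rewrite nth_mkseq //.
  rewrite /char_fun /column;
  case: (boolP (_ \in X)) => [/set_mem Xw|/negP Xw] /eqP <- //=.
  by move=> Xw'; apply: Xw; apply: mem_set.
rewrite mem_iota => il; have := H i; rewrite /= size_mkseq => /(_ il).
rewrite nth_mkseq // /char_fun /column; case: (bit m i) => [Xw|nXw].
  by rewrite mem_set.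
by rewrite memNset.
Qed.

Lemma string_code (sigma : seq bool) :
  mkseq (bit (pack (nth false sigma) (size sigma))) (size sigma) = sigma.
Proof.
rewrite -[RHS](mkseq_nth false); apply/eq_in_map => i.
by rewrite mem_iota bit_pack => /= ->.
Qed.

(** The columns are computable, though not uniformly so; as only finitely many
    columns are involved, their intersection is computable. *)
Lemma effective_in_tail X r : (forall n, computable_set (column X n)) ->
  effective_pred false (fun _ w => in_tail (char_fun X) r w).
Proof.
move=> cX; rewrite /in_tail; apply: effective_and; first by effectively.
rewrite /in_string; elim: (pi1 r) => [|l IHl]; first exact: effective_const.
apply: (@effective_ext _ (fun _ w =>
  all (fun i => (char_fun X (cpair w i) == 1) == bit (pi1 (pi2 r)) i) (iota 0 l) &&
  ((char_fun (column X l) w == 1) == bit (pi1 (pi2 r)) l))).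
  by move=> _ w; rewrite -[l.+1]addn1 iotaD all_cat /= andbT.
have eXl : effective false (fun _ w => char_fun (column X l) w) := cX l.
by effectively.
Qed.

Lemma finite_bounded (A : set nat) : finite_set A -> exists N, forall w, A w -> w < N.
Proof.
move=> /finite_seqP[s ->]; exists (\max_(w <- s) w).+1 => w /= ws.
by rewrite ltnS; apply: (leq_bigmax_seq (F := id)).
Qed.

(** The tail of F_sigma is infinite and computable, so an index [c] of it
    accepts arbitrarily many of its elements in the last block. *)
Lemma divergent_refuted X e x r : maximal_independent (column X) ->
  (forall s, ~~ converged e x s) -> exists s, refuted (char_fun X) e r s.
Proof.
move=> [cX indep _] /reach_stabilizes[b stable].
have [c oc cP] := effective_in_tail r cX.
have tail_sound w t : derived (num c) w 1 t -> in_tail (char_fun X) r w.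
  move=> /(derived_sound (fun=> 0) oc) d.
  by have := eval_functional (cP (fun=> 0) w) d; case: in_tail.
have tail_complete w : in_tail (char_fun X) r w -> eventually (derived (num c) w 1).
  move=> tw; apply: (@derived_complete (fun=> 0)) => //.
  by have := cP (fun=> 0) w; rewrite tw.
have inf : infinite_set (string_set (column X) (mkseq (bit (pi1 (pi2 r))) (pi1 r))
    `\` `I_(maxn b (pi2 (pi2 r)))).
  by apply: infinite_setD; [exact: indep | exact: finite_II].
have [B BA sB] := infinite_set_fset (num c).*2.+2 inf.
have BP w : w \in B -> b <= w /\ in_tail (char_fun X) r w.
  move=> /BA [/in_stringP ws] /negP; rewrite -leqNgt geq_max => /andP[bw Nw].
  by split=> //; apply/andP.
have [t Ht] : eventually (fun t => (num c < t /\ b <= t) /\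
    forall w, w \in B -> w < t /\ derived (num c) w 1 t).
  apply: eventually_and; first by apply: eventually_and (eventually_gt _) _; exists b.
  apply: eventually_all => w /BP[_ tw].
  by apply: eventually_and (eventually_gt w) _; exact: tail_complete.
have [[it bt] tB] := Ht t (leqnn t).
(* the index of the tail refutes at stage t, being large and accepting nothing else *)
exists t.+1; apply/hasP; exists t; first by rewrite mem_iota /=.
apply/hasP; exists (num c); first by rewrite mem_iota.
apply/andP; split; last first.
  apply/allP => w _; rewrite -implybE; apply/implyP => /andP[_].
  exact: tail_sound.
rewrite /large; apply: leq_trans sB _; rewrite -size_filter.
apply: uniq_leq_size (fset_uniq B) _ => w wB.
have [wt dw] := tB w wB; have [bw _] := BP w wB.
by rewrite mem_filter mem_iota /= wt andbT /marked dw !stable // eqxx.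
Qed.

Lemma halted_total X : maximal_independent (column X) ->
  forall x, exists s, halted (char_fun X) x s.
Proof.
move=> mX x.
have settle q : q \in iota 0 x -> eventually (fun s =>
    converged (pi1 q) x s || refuted (char_fun X) (pi1 q) (pi2 q) s).
  move=> _; have [[s cs]|div] := pselect (exists s, converged (pi1 q) x s).
    by exists s => t st; rewrite (converged_mono st).
  have [|s rs] := @divergent_refuted X (pi1 q) x (pi2 q) mX.
    by move=> s; apply/negP => cs; apply: div; exists s.
  by exists s => t st; rewrite [X in _ || X](has_iota_mono st) ?orbT.
have [s Hs] := eventually_and (eventually_gt x) (eventually_all settle).
have [xs qs] := Hs s (leqnn s).
by exists s; rewrite /halted ltnW //; apply/allP.
Qed.

(** By maximality some tail of F_sigma lies on one side of the splitting set
    [R], while every large set has elements on both sides. *)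
Lemma total_unrefuted X e : maximal_independent (column X) ->
  (forall x, exists s, converged e x s) ->
  exists r, forall s, ~~ refuted (char_fun X) e r s.
Proof.
move=> [_ _ maxX] /splitting_set[R cR splitR].
have [sigma] := maxX R cR.
pose r N := cpair (size sigma) (cpair (pack (nth false sigma) (size sigma)) N).
have tailP N w : in_tail (char_fun X) (r N) w ->
    N <= w /\ string_set (column X) sigma w.
  rewrite /in_tail /r !pi_cpair => /andP[-> /in_stringP].
  by rewrite string_code.
(* both sides of R are treated at once, P being the side that contains the tail *)
have unrefuted N (P : nat -> Prop) :
    (forall i t, i < t -> large e i t -> exists2 a, a < t & marked e i t a /\ ~ P a) ->
    (forall w, in_tail (char_fun X) (r N) w -> P w) ->
    forall s, ~~ refuted (char_fun X) e (r N) s.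
  move=> HP tP s; apply/negP => /hasP[t _ /hasP[i]]; rewrite mem_iota => /= it.
  move=> /andP[/(HP _ _ it)[a at_ [ma nPa]] /allP/(_ a)].
  by rewrite mem_iota /= ma => /(_ at_)/tP.
move=> [] /finite_bounded[N HN]; exists (r N).
- apply: (unrefuted N R) => [i t it /(splitR _ _ it)[]//|w /tailP[Nw sw]].
  by apply: contrapT => nR; have := HN w (conj sw nR); rewrite ltnNge Nw.
- apply: (unrefuted N (~` R)) =>
    [i t it /(splitR _ _ it)[[a at_ [ma Ra]] _]|w /tailP[Nw sw] Rw].
    by exists a => //; split=> // nR; apply: nR.
  by have := HN w (conj sw (fun nR => nR Rw)); rewrite ltnNge Nw.
Qed.

(** * The dominating function *)

Theorem theorem4p2 : medvedev_le DomFcn (char_fun @` MaxIndep).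
Proof.
have [Theta _ ThetaP] := effective_search effective_halted.
exists Theta => _ [X mX <-].
have H := halted_total mX.
exists (fun x => ex_minn (H x)) => [|x]; last exact: ThetaP.
split=> [f [c oc cf]|x]; last by case: ex_minnP => s /andP[].
have tot x : exists s, converged (num c) x s.
  have [s Hs] := eventually_and (eventually_gt (f x))
    (derived_complete oc (cf (fun=> 0) x)).
  have [fs ds] := Hs s (leqnn s).
  by exists s; apply/hasP; exists (f x); rewrite ?mem_iota.
have [r unref] := total_unrefuted mX tot.
(* past the code of the pair of c and its witness, h(x) waits for c(x) *)
exists (cpair (num c) r).+1 => x qx.
case: ex_minnP => s /andP[_ /allP/(_ (cpair (num c) r))] + _.
rewrite mem_iota !pi_cpair (negPf (unref s)) orbF => /(_ qx)/hasP[y].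
rewrite mem_iota => /= ys /(derived_sound (fun=> 0) oc) ey.
by rewrite (eval_functional (cf (fun=> 0) x) ey) ltnW.
Qed.
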